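(* Let $\mathbb{K}$ be an algebraically closed field of characteristic $0$. The $7$-dimensional nilpotent Lie algebra $\mathfrak{g}$ over $\mathbb{K}$ with basis $X_1,\dots,X_7$ whose Lie bracket is $$[X_1,X_{3i-1}]=X_{3i},\quad [X_1,X_{3i}]=X_{3i+1}\quad (i=1,2),$$ $$[X_2,X_3]=X_4+X_7,\quad [X_3,X_5]=X_7,\quad [X_5,X_6]=X_4,\quad [X_2,X_5]=X_6$$ (other brackets of basis vectors being zero or deduced by skew-symmetry) is rigid in $3Nilp_7$. Any $7$-dimensional Lie algebra of characteristic sequence $(3,3,1)$ is a contraction of $\mathfrak{g}$.
   Context: $3Nilp_n$ is the algebraic variety of all Lie brackets $\mu$ on $\mathbb{K}^n$ satisfying $\mu(\mu(\mu(X,Y),Z),T)=0$ for all $X,Y,Z,T$ (viewed in $\mathbb{K}^{n^3}$ via structure constants); a Lie algebra $(\mathbb{K}^n,\mu)$ is identified with $\mu$. The group $GL(n,\mathbb{K})$ acts by $(f\cdot\mu)(X,Y)=f^{-1}\mu(f(X),f(Y))$. $\mu\in 3Nilp_n$ is rigid in $3Nilp_n$ if its orbit is Zariski open in $3Nilp_n$. A contraction of $\mu$ is a Lie algebra law in the Zariski closure of the orbit of $\mu$. For a nilpotent Lie algebra $\mathfrak{g}$ and $X\in\mathfrak{g}$, $c(X)$ is the decreasing sequence of the dimensions of the Jordan blocks of $\mathrm{ad}(X)$; the characteristic sequence of $\mathfrak{g}$ is $c(\mathfrak{g})=\max\{c(X): X\in\mathfrak{g}\setminus[\mathfrak{g},\mathfrak{g}]\}$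 for the lexicographic order. The second sentence of the claim concerns $3$-step nilpotent Lie algebras over $\mathbb{K}$. *)

(* Defs.v *)
From HB Require Import structures.
From mathcomp Require Import all_boot all_order all_algebra.
From mathcomp Require Export mpoly.

Set Implicit Arguments.
Unset Strict Implicit.
Unset Printing Implicit Defensive.

Import Order.TTheory GRing.Theory.
Local Open Scope ring_scope.

(* A point of K^(n^3): [mu (i, j, k)] is the coefficient of e_k in [e_i, e_j]. *)
Definition law (K : fieldType) (n : nat) : Type :=
  {ffun 'I_n * 'I_n * 'I_n -> K}.

(* Vectors of K^n are rows, so linear maps act by right multiplication. *)
Definition bracket (K : fieldType) (n : nat) (mu : law K n)
    (X Y : 'rV[K]_n) : 'rV[K]_n :=
  \row_k \sum_i \sum_j X 0 i * Y 0 j * mu (i, j, k).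

Definition struct_const (K : fieldType) (n : nat)
    (b : 'rV[K]_n -> 'rV[K]_n -> 'rV[K]_n) : law K n :=
  [ffun t => b (delta_mx 0 t.1.1) (delta_mx 0 t.1.2) 0 t.2].

Definition is_lie (K : fieldType) (n : nat) (mu : law K n) : Prop :=
  (forall X, bracket mu X X = 0) /\
  (forall X Y Z, bracket mu (bracket mu X Y) Z + bracket mu (bracket mu Y Z) X
                 + bracket mu (bracket mu Z X) Y = 0).

Definition nilp3 (K : fieldType) (n : nat) (mu : law K n) : Prop :=
  is_lie mu /\
  (forall X Y Z T, bracket mu (bracket mu (bracket mu X Y) Z) T = 0).

Definition gl_act (K : fieldType) (n : nat) (f : 'M[K]_n) (mu : law K n) :
    law K n :=
  struct_const (fun X Y => bracket mu (X *m f) (Y *m f) *m invmx f).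

Definition gl_orbit (K : fieldType) (n : nat) (mu nu : law K n) : Prop :=
  exists2 f : 'M[K]_n, f \in unitmx & nu = gl_act f mu.

Definition coords (K : fieldType) (n : nat) (mu : law K n) :
    'I_#|{: 'I_n * 'I_n * 'I_n}| -> K :=
  fun i => mu (enum_val i).

Definition zariski_closed (K : fieldType) (n : nat) (Z : law K n -> Prop) :
    Prop :=
  exists I : {mpoly K[#|{: 'I_n * 'I_n * 'I_n}|]} -> Prop,
    forall mu, Z mu <-> (forall p, I p -> p.@[coords mu] = 0).

Definition zariski_open (K : fieldType) (n : nat) (U : law K n -> Prop) :
    Prop :=
  zariski_closed (fun mu => ~ U mu).

Definition zariski_open_in (K : fieldType) (n : nat) (V A : law K n -> Prop) :
    Prop :=
  exists2 U : law K n -> Prop, zariski_open U &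
    forall mu, A mu <-> V mu /\ U mu.

Definition zariski_closure (K : fieldType) (n : nat) (A : law K n -> Prop) :
    law K n -> Prop :=
  fun mu => forall Z : law K n -> Prop, zariski_closed Z ->
    (forall nu, A nu -> Z nu) -> Z mu.

Definition rigid_in_nilp3 (K : fieldType) (n : nat) (mu : law K n) : Prop :=
  zariski_open_in (@nilp3 K n) (gl_orbit mu).

Definition contraction (K : fieldType) (n : nat) (mu nu : law K n) : Prop :=
  is_lie nu /\ zariski_closure (gl_orbit mu) nu.

(* [g, g] as the smallest subspace containing all brackets. *)
Definition in_derived (K : fieldType) (n : nat) (mu : law K n)
    (X : 'rV[K]_n) : Prop :=
  forall U : {vspace 'rV[K]_n},
    (forall Y Z, bracket mu Y Z \in U) -> X \in U.

Definition ad (K : fieldType) (n : nat) (mu : law K n) (X : 'rV[K]_n) :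
    'M[K]_n :=
  lin1_mx (bracket mu X).

Definition jordan_block (K : fieldType) (m : nat) (a : K) : 'M[K]_m :=
  \matrix_(i, j) ((i == j)%:R * a + (i.+1 == j :> nat)%:R).

(* The rows of P are a Jordan basis; [row_free] and [row_full] together force
   the block sizes to sum to n, which avoids a cast between matrix sizes. *)
Definition jordan_sizes (K : fieldType) (n : nat) (A : 'M[K]_n) (s : seq nat) :
    Prop :=
  [/\ sorted geq s, 0%N \notin s &
    exists (a : 'I_(size s) -> K)
           (P : 'M[K]_(\sum_(i < size s) nth 0%N s i, n)),
      [/\ row_free P, row_full P &
        P *m A = (\mxdiag_(i < size s) jordan_block (nth 0%N s i) (a i)) *m P]].

Definition char_seq (K : fieldType) (n : nat) (mu : law K n) (s : seq nat) :
    Prop :=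
  (exists2 X, ~ in_derived mu X & jordan_sizes (ad mu X) s) /\
  (forall X t, ~ in_derived mu X -> jordan_sizes (ad mu X) t ->
     ((t : seqlexi nat) <= s)%O).

(* A triple (i, j, k) with i < j stands for a term X_k, with coefficient 1, in
   [X_i, X_j]; so (2, 3, 4) and (2, 3, 7) encode [X_2, X_3] = X_4 + X_7. *)
Definition g_terms : seq (nat * nat * nat) :=
  [:: (1, 2, 3); (1, 3, 4); (1, 5, 6); (1, 6, 7);
      (2, 3, 4); (2, 3, 7); (3, 5, 7); (5, 6, 4); (2, 5, 6)]%N.

(* X_i is the basis vector of index i - 1 in 'I_7. *)
Definition g_law (K : fieldType) : law K 7 :=
  [ffun t : 'I_7 * 'I_7 * 'I_7 =>
     let s := (t.1.1.+1, t.1.2.+1, t.2.+1) in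
     let s' := (t.1.2.+1, t.1.1.+1, t.2.+1) in
     (s \in g_terms)%:R - (s' \in g_terms)%:R].

(* Main.v *)
(* Let mu be a 3-step nilpotent law in dimension 7 and v, y, t vectors such that
   ad(v)^2 y and ad(v)^2 t are independent; characteristic sequence (3,3,1)
   provides such vectors.  Then g/[g,g] contains a plane P, transverse to v,
   whose brackets are central, and x y |-> [x, [v, y]] induces a map
   Sym^2 P -> g^3.  In a basis v, p, q, [v, p], [v, q], [v, [v, p]],
   [v, [v, q]] with P = <p, q>, the structure constants of mu depend affinely on
   8 free parameters.  If the kernel of Sym^2 P -> g^3 is spanned by a product ab
   of independent vectors and the cubic form
   x |-> [v, [v, x]] /\ [x, [v, x]] on P vanishes neither at a nor at b, then mu
   is isomorphic to one normal form, by a change of basis that needs only a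
   square root and a cube root.  This genericity condition is the nonvanishing
   of a polynomial in mu and it holds for g, so the orbit of g is open, and it is
   dense in the 8-parameter family. *)

From HB Require Import structures.
Require Import Defs.
From mathcomp Require Import all_boot all_order all_algebra.
From mathcomp Require Import ring.

Set Implicit Arguments.
Unset Strict Implicit.
Unset Printing Implicit Defensive.

Import GRing.Theory.
Local Open Scope ring_scope.

(** * Laws and the action of GL_n *)

Section Bracket.
Variables (K : fieldType) (n : nat).
Implicit Types (mu : law K n) (X Y Z : 'rV[K]_n) (f g : 'M[K]_n).

Lemma bracketDl mu X X' Y :
  bracket mu (X + X') Y = bracket mu X Y + bracket mu X' Y.
Proof.
apply/rowP=> k; rewrite !mxE -big_split /=; apply: eq_bigr => i _.
by rewrite -big_split /=; apply: eq_bigr => j _; rewrite !mxE; ring.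
Qed.

Lemma bracketDr mu X Y Y' :
  bracket mu X (Y + Y') = bracket mu X Y + bracket mu X Y'.
Proof.
apply/rowP=> k; rewrite !mxE -big_split /=; apply: eq_bigr => i _.
by rewrite -big_split /=; apply: eq_bigr => j _; rewrite !mxE; ring.
Qed.

Lemma bracketZl mu a X Y : bracket mu (a *: X) Y = a *: bracket mu X Y.
Proof.
apply/rowP=> k; rewrite !mxE big_distrr /=; apply: eq_bigr => i _.
by rewrite big_distrr /=; apply: eq_bigr => j _; rewrite !mxE; ring.
Qed.

Lemma bracketZr mu a X Y : bracket mu X (a *: Y) = a *: bracket mu X Y.
Proof.
apply/rowP=> k; rewrite !mxE big_distrr /=; apply: eq_bigr => i _.
by rewrite big_distrr /=; apply: eq_bigr => j _; rewrite !mxE; ring.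
Qed.

Lemma bracket0l mu Y : bracket mu 0 Y = 0.
Proof. by rewrite -(scale0r 0) bracketZl !scale0r. Qed.

Lemma bracket0r mu X : bracket mu X 0 = 0.
Proof. by rewrite -(scale0r 0) bracketZr !scale0r. Qed.

Lemma bracketNl mu X Y : bracket mu (- X) Y = - bracket mu X Y.
Proof. by rewrite -scaleN1r bracketZl scaleN1r. Qed.

Lemma bracketNr mu X Y : bracket mu X (- Y) = - bracket mu X Y.
Proof. by rewrite -scaleN1r bracketZr scaleN1r. Qed.

Lemma linear_sum_delta (b : 'rV[K]_n -> 'rV[K]_n) X :
  linear b -> b X = \sum_i X 0 i *: b (delta_mx 0 i).
Proof.
move=> lb.
pose fb : {linear 'rV[K]_n -> 'rV[K]_n} :=
  HB.pack b (GRing.isLinear.Build K 'rV[K]_n 'rV[K]_n *:%R b lb).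
rewrite -[b]/(fb : _ -> _) {1}(row_sum_delta X) linear_sum /=.
by apply: eq_bigr => i _; exact: (linearZ_LR fb).
Qed.

Lemma bracket_struct_const (b : 'rV[K]_n -> 'rV[K]_n -> 'rV[K]_n) X Y :
  (forall Y, linear (b^~ Y)) -> (forall X, linear (b X)) ->
  bracket (struct_const b) X Y = b X Y.
Proof.
move=> bl br; rewrite (linear_sum_delta X (bl Y)); apply/rowP=> k.
rewrite !mxE summxE; apply: eq_bigr => i _.
rewrite mxE (linear_sum_delta Y (br _)) summxE big_distrr /=.
by apply: eq_bigr => j _; rewrite ffunE !mxE /=; ring.
Qed.

Lemma law_ext mu nu :
  (forall X Y, bracket mu X Y = bracket nu X Y) -> mu = nu.
Proof.
suff H mu' : mu' = struct_const (bracket mu').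
  move=> e; rewrite (H mu) (H nu).
  by apply/ffunP=> t; rewrite !ffunE e.
apply/ffunP=> -[[i j] k]; rewrite ffunE mxE /= (bigD1 i) //= (bigD1 j) //=.
rewrite !mxE !eqxx !mul1r !big1 ?addr0 // => [i' ni|j' nj].
  by rewrite big1 // => j' _; rewrite mxE (negPf ni) !mul0r.
by rewrite !mxE (negPf nj) andbF mulr0 mul0r.
Qed.

Lemma bracket_gl_act f mu X Y :
  bracket (gl_act f mu) X Y = bracket mu (X *m f) (Y *m f) *m invmx f.
Proof.
apply: (@bracket_struct_const
          (fun X Y => bracket mu (X *m f) (Y *m f) *m invmx f)).
- by move=> Z a U V; rewrite mulmxDl -scalemxAl bracketDl bracketZl mulmxDl
    -scalemxAl.
- by move=> Z a U V; rewrite mulmxDl -scalemxAl bracketDr bracketZr mulmxDl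
    -scalemxAl.
Qed.

Lemma gl_actM f g mu : f \in unitmx -> g \in unitmx ->
  gl_act f (gl_act g mu) = gl_act (f *m g) mu.
Proof.
move=> uf ug; apply: law_ext => X Y; rewrite !bracket_gl_act !mulmxA.
rewrite -!mulmxA; congr (_ *m _).
have ufg : f *m g \in unitmx by rewrite unitmx_mul uf.
by rewrite -[LHS]mulmx1 -(mulmxV ufg) !mulmxA mulmxKV // mulVmx // mul1mx.
Qed.

Lemma gl_actK f mu : f \in unitmx -> gl_act (invmx f) (gl_act f mu) = mu.
Proof.
move=> uf; rewrite gl_actM ?unitmx_inv // mulVmx //.
apply: law_ext => X Y.
by rewrite bracket_gl_act invmx1 !mulmx1.
Qed.

Lemma gl_orbit_sym mu nu : gl_orbit mu nu -> gl_orbit nu mu.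
Proof.
case=> f uf ->; exists (invmx f); first by rewrite unitmx_inv.
by rewrite gl_actK.
Qed.

Lemma gl_orbit_trans mu nu xi :
  gl_orbit mu nu -> gl_orbit nu xi -> gl_orbit mu xi.
Proof.
case=> f uf -> [g ug ->]; exists (g *m f); first by rewrite unitmx_mul ug.
by rewrite gl_actM.
Qed.

Lemma nilp3_gl_orbit mu nu : gl_orbit mu nu -> nilp3 mu -> nilp3 nu.
Proof.
case=> f uf -> [[mu0 muJ] mu3]; split; first split.
- by move=> X; rewrite bracket_gl_act mu0 mul0mx.
- move=> X Y Z; rewrite !bracket_gl_act !mulmxKV // -!mulmxDl.
  by rewrite muJ mul0mx.
- by move=> X Y Z T; rewrite !bracket_gl_act !mulmxKV // mu3 mul0mx.
Qed.

End Bracket.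

Lemma rowDE (K : fieldType) n (x y : 'rV[K]_n) k : (x + y) 0 k = x 0 k + y 0 k.
Proof. by rewrite mxE. Qed.

Lemma rowNE (K : fieldType) n (x : 'rV[K]_n) k : (- x) 0 k = - x 0 k.
Proof. by rewrite mxE. Qed.

Lemma rowZE (K : fieldType) n a (x : 'rV[K]_n) k : (a *: x) 0 k = a * x 0 k.
Proof. by rewrite mxE. Qed.

Lemma row0E (K : fieldType) n k : (0 : 'rV[K]_n) 0 k = 0.
Proof. by rewrite mxE. Qed.

Definition coordE := (rowDE, rowNE, rowZE, row0E).

Ltac coord_ring :=
  repeat match goal with
  | |- context [@fun_of_matrix ?R ?m ?n ?x ?i ?j] =>
      generalize (@fun_of_matrix R m n x i j) => ?
  end; ring.

(* [mxE] would unfold [bracket], so only the module operations are pushed to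
   the coordinates. *)
Ltac row_ring := apply/rowP=> ?; rewrite ?coordE; coord_ring.

(** * Minors as tests of independence *)

Section Minor.
Variables (K : fieldType) (n : nat) (phi psi : 'cV[K]_n).
Implicit Types x y : 'rV[K]_n.

Definition pairing (phi : 'cV[K]_n) x : K := (x *m phi) 0 0.

Lemma pairingD phi0 x y :
  pairing phi0 (x + y) = pairing phi0 x + pairing phi0 y.
Proof. by rewrite /pairing mulmxDl mxE. Qed.

Lemma pairingZ phi0 a x : pairing phi0 (a *: x) = a * pairing phi0 x.
Proof. by rewrite /pairing -scalemxAl mxE. Qed.

Lemma pairingN phi0 x : pairing phi0 (- x) = - pairing phi0 x.
Proof. by rewrite /pairing mulNmx mxE. Qed.

Lemma pairing0 phi0 : pairing phi0 0 = 0.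
Proof. by rewrite /pairing mul0mx mxE. Qed.

Definition pairingE := (pairingD, pairingZ, pairingN, pairing0).

(** A polynomial certificate of independence: if it is nonzero for some forms [phi] and [psi], then
    x and y are independent. *)
Definition minor x y : K :=
  pairing phi x * pairing psi y - pairing psi x * pairing phi y.

End Minor.

(** * Identities in 3-step nilpotent Lie algebras *)

Definition bracketE :=
  (bracketDl, bracketDr, bracketZl, bracketZr, bracketNl, bracketNr,
   bracket0l, bracket0r).

Section Nilp3.
Variables (K : fieldType) (n : nat) (mu : law K n).
Hypothesis mu_nilp : nilp3 mu.
Local Notation "[ x , y ]" := (bracket mu x y).
Implicit Types x y z t u v : 'rV[K]_n.

Lemma bracketxx x : [x, x] = 0.
Proof. by case: mu_nilp => -[]. Qed.

Lemma bracketC x y : [x, y] = - [y, x].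
Proof.
have := bracketxx (x + y).
by rewrite !bracketE !bracketxx add0r addr0 => /eqP; rewrite addr_eq0 => /eqP.
Qed.

Lemma jacobi x y z : [x, [y, z]] = [[x, y], z] + [y, [x, z]].
Proof.
case: mu_nilp => -[_ /(_ x y z)] + _.
rewrite (bracketC _ x) (bracketC [z, x]) (bracketC z x) !bracketE opprK => h.
apply/eqP; rewrite -subr_eq0 -[X in _ == X]oppr0 -h; apply/eqP. row_ring.
Qed.

Lemma bracket_nilp x y z t : [[[x, y], z], t] = 0.
Proof. by case: mu_nilp. Qed.

Lemma bracket_nilpr x y z t : [t, [z, [x, y]]] = 0.
Proof.
by rewrite bracketC (bracketC z) bracketNl bracket_nilp !oppr0.
Qed.

(** The Jacobi identity expands this into two fourfold brackets; thus the derived algebra is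
    abelian. *)
Lemma bracket_derived x y z t : [[x, y], [z, t]] = 0.
Proof.
rewrite jacobi bracket_nilp add0r bracketC (bracketC [x, y]).
by rewrite bracketE bracketC bracket_nilpr !oppr0.
Qed.

(** This symmetry lets x y |-> [x, [v, y]] be defined on Sym^2 of a plane where [v, [x, y]]
    vanishes. *)
Lemma bracket_flip v x y : [v, [x, y]] = 0 -> [y, [v, x]] = [x, [v, y]].
Proof.
by rewrite jacobi (bracketC [v, x]) => /eqP; rewrite addrC subr_eq0 => /eqP.
Qed.

End Nilp3.

(** * Frames adapted to a vector v with ad(v)^2 of rank 2 *)

Definition i0 := @Ordinal 7 0 isT.
Definition i1 := @Ordinal 7 1 isT.
Definition i2 := @Ordinal 7 2 isT.
Definition i3 := @Ordinal 7 3 isT.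
Definition i4 := @Ordinal 7 4 isT.
Definition i5 := @Ordinal 7 5 isT.
Definition i6 := @Ordinal 7 6 isT.

Lemma forall_ord7 (P : 'I_7 -> Prop) :
  P i0 -> P i1 -> P i2 -> P i3 -> P i4 -> P i5 -> P i6 -> forall i, P i.
Proof.
move=> P0 P1 P2 P3 P4 P5 P6 [[|[|[|[|[|[|[|//]]]]]]] lti].
- by rewrite (_ : Ordinal lti = i0) //; apply: val_inj.
- by rewrite (_ : Ordinal lti = i1) //; apply: val_inj.
- by rewrite (_ : Ordinal lti = i2) //; apply: val_inj.
- by rewrite (_ : Ordinal lti = i3) //; apply: val_inj.
- by rewrite (_ : Ordinal lti = i4) //; apply: val_inj.
- by rewrite (_ : Ordinal lti = i5) //; apply: val_inj.
- by rewrite (_ : Ordinal lti = i6) //; apply: val_inj.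
Qed.

Lemma sum_ord7 (V : nmodType) (F : 'I_7 -> V) :
  \sum_i F i = F i0 + F i1 + F i2 + F i3 + F i4 + F i5 + F i6.
Proof.
rewrite !big_ord_recr big_ord0 /= add0r.
by congr (F _ + F _ + F _ + F _ + F _ + F _ + F _); apply: val_inj.
Qed.

Lemma mulmx_rows7 (K : fieldType) (c : 'rV[K]_7) (s : seq 'rV[K]_7) :
  c *m (\matrix_(i < 7) nth 0 s i) =
  c 0 i0 *: s`_0 + c 0 i1 *: s`_1 + c 0 i2 *: s`_2 + c 0 i3 *: s`_3 +
  c 0 i4 *: s`_4 + c 0 i5 *: s`_5 + c 0 i6 *: s`_6.
Proof. by rewrite mulmx_sum_row sum_ord7 !rowK. Qed.

Section Frame.
Variables (K : fieldType) (mu : law K 7).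
Hypothesis mu_nilp : nilp3 mu.
Local Notation "[ x , y ]" := (bracket mu x y).
Variables (v y t : 'rV[K]_7).

Definition frame : 'M[K]_7 :=
  \matrix_(i < 7)
    [:: v; y; t; [v, y]; [v, t]; [v, [v, y]]; [v, [v, t]]]`_i.

Lemma mulmx_frame (c : 'rV[K]_7) :
  c *m frame = c 0 i0 *: v + c 0 i1 *: y + c 0 i2 *: t
    + c 0 i3 *: [v, y] + c 0 i4 *: [v, t]
    + c 0 i5 *: [v, [v, y]] + c 0 i6 *: [v, [v, t]].
Proof. exact: mulmx_rows7. Qed.

Variables (phi psi : 'cV[K]_7).
Hypothesis minor_neq0 : minor phi psi [v, [v, y]] [v, [v, t]] != 0.

(** Pairing the relation with [phi] and [psi] gives a linear system in a and b whose determinant is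
    the minor. *)
Lemma frame_top_free a b :
  a *: [v, [v, y]] + b *: [v, [v, t]] = 0 -> a = 0 /\ b = 0.
Proof.
move=> h.
have e f : a * pairing f [v, [v, y]] + b * pairing f [v, [v, t]] = 0.
  by rewrite -!pairingZ -pairingD h pairing0.
move: minor_neq0; rewrite /minor => d0.
split; apply: (mulIf d0); rewrite mul0r.
  transitivity (0 * pairing psi [v, [v, t]] - 0 * pairing phi [v, [v, t]]).
    by rewrite -{1}(e phi) -(e psi); ring.
  by ring.
transitivity (0 * pairing phi [v, [v, y]] - 0 * pairing psi [v, [v, y]]).
  by rewrite -{1}(e psi) -(e phi); ring.
by ring.
Qed.

(** A second application of ad(v) leaves only the coefficients of y and t, on the two free top
    vectors; the first application then yields those of [v, y] and [v, t]. *)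
Lemma frame_ker_ad (c : 'rV[K]_7) : [v, c *m frame] = 0 ->
  [/\ c 0 i1 = 0, c 0 i2 = 0, c 0 i3 = 0 & c 0 i4 = 0].
Proof.
rewrite mulmx_frame !bracketE !(bracketxx mu_nilp) !(bracket_nilpr mu_nilp).
rewrite !(scaler0, addr0, add0r) => h1.
have : [v, 0] = 0 by rewrite bracket0r.
rewrite -{1}h1 !bracketE !(bracket_nilpr mu_nilp) !(scaler0, addr0).
case/frame_top_free=> c1 c2; move: h1; rewrite c1 c2 !scale0r !add0r.
by case/frame_top_free.
Qed.

(** Only v and the top vectors remain after [frame_ker_ad], and bracketing with [v, y] isolates the
    coefficient of v. *)
Lemma mulmx_frame_ad (c : 'rV[K]_7) :
    [v, c *m frame] = 0 -> [c *m frame, [v, y]] = 0 ->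
  c 0 i0 = 0 /\
  c *m frame = c 0 i5 *: [v, [v, y]] + c 0 i6 *: [v, [v, t]].
Proof.
case/frame_ker_ad=> c1 c2 c3 c4.
rewrite mulmx_frame c1 c2 c3 c4 !scale0r !addr0.
rewrite !bracketE !(bracket_derived mu_nilp) !(scaler0, addr0).
move=> h; have [|-> _] := @frame_top_free (c 0 i0) 0.
  by rewrite h scale0r addr0.
by rewrite scale0r add0r.
Qed.

Lemma frame_unit : frame \in unitmx.
Proof.
rewrite -row_free_unit; apply: inj_row_free => c hc.
have [|c1 c2 c3 c4] := @frame_ker_ad c; first by rewrite hc bracket0r.
have [||c0] := @mulmx_frame_ad c; rewrite ?hc ?bracket0r ?bracket0l //.
move/esym/frame_top_free=> [c5 c6].
by apply/rowP; elim/forall_ord7; rewrite mxE.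
Qed.

(** Every [x, [w, z]] passes this two-equation test, so g^3 lies in the plane of the two top
    vectors. *)
Lemma frame_top_span x : [v, x] = 0 -> [x, [v, y]] = 0 ->
  exists a b, x = a *: [v, [v, y]] + b *: [v, [v, t]].
Proof.
rewrite -[x](mulmxKV frame_unit) => vx xw.
by have [_ ->] := mulmx_frame_ad vx xw; do 2!eexists.
Qed.

(** Three vectors of one plane satisfy Cramer's relation; written without division, it stays
    polynomial in the law. *)
Lemma minor_cramer x y' t' :
    let top x := [v, x] = 0 /\ [x, [v, y]] = 0 in
    top x -> top y' -> top t' ->
  minor phi psi x y' *: t' =
    minor phi psi t' y' *: x + minor phi psi x t' *: y'.
Proof.
move=> top; case=> /frame_top_span h /h [a [b ->]].
case=> /frame_top_span h1 /h1 [a1 [b1 ->]].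
case=> /frame_top_span h2 /h2 [a2 [b2 ->]].
by rewrite /minor !pairingE; row_ring.
Qed.

End Frame.

(** * The 8-parameter family *)

Section Model.
Variables (K : fieldType).
Implicit Types (c : nat -> K) (x y : 'rV[K]_7).

(* In the basis v, p, q, [v, p], [v, q], z1 = [v, [v, p]], z2 = [v, [v, q]],
   the numbers [c 0 .. c 7] are the coordinates on (z1, z2) of [p, [v, p]], of
   [p, [v, q]] = [q, [v, p]], of [q, [v, q]] and of [p, q]. *)
Definition model_mul c x y : 'rV[K]_7 :=
  let s i j := x 0 i * y 0 j - x 0 j * y 0 i in
  \row_k [:: 0; 0; 0; s i0 i1; s i0 i2;
    s i0 i3 + c 0%N * s i1 i3 + c 2%N * (s i1 i4 + s i2 i3) + c 4%N * s i2 i4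
      + c 6%N * s i1 i2;
    s i0 i4 + c 1%N * s i1 i3 + c 3%N * (s i1 i4 + s i2 i3) + c 5%N * s i2 i4
      + c 7%N * s i1 i2]`_k.

Definition model c : law K 7 := struct_const (model_mul c).

Lemma model_mulE c x y : let s i j := x 0 i * y 0 j - x 0 j * y 0 i in
  ((model_mul c x y 0 i0 = 0) * (model_mul c x y 0 i1 = 0) *
   (model_mul c x y 0 i2 = 0) * (model_mul c x y 0 i3 = s i0 i1) *
   (model_mul c x y 0 i4 = s i0 i2) *
   (model_mul c x y 0 i5 = (s i0 i3 + c 0%N * s i1 i3
      + c 2%N * (s i1 i4 + s i2 i3) + c 4%N * s i2 i4 + c 6%N * s i1 i2)%R) *
   (model_mul c x y 0 i6 = (s i0 i4 + c 1%N * s i1 i3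
      + c 3%N * (s i1 i4 + s i2 i3) + c 5%N * s i2 i4
      + c 7%N * s i1 i2)%R))%type.
Proof. by rewrite /= !mxE. Qed.

Lemma eq_model c c' : c =1 c' -> model c = model c'.
Proof.
by move=> ecc; apply/ffunP=> t; rewrite !ffunE !mxE !ecc.
Qed.

Lemma bracket_model c x y : bracket (model c) x y = model_mul c x y.
Proof.
apply: bracket_struct_const => z a u w; apply/rowP; elim/forall_ord7;
  by rewrite ?(coordE, model_mulE) ?coordE; coord_ring.
Qed.

(** The last two coordinates are central and contain all double brackets. Jacobi on v, p, q reduces
    to [p, [v, q]] = [q, [v, p]], which is built into [model_mul]. *)
Lemma model_nilp3 c : nilp3 (model c).
Proof.
split; first split.
- move=> x; rewrite bracket_model.
  by apply/rowP; elim/forall_ord7; rewrite coordE model_mulE; coord_ring.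
- move=> x y z; rewrite !bracket_model.
  by apply/rowP; elim/forall_ord7; rewrite !(coordE, model_mulE); coord_ring.
- move=> x y z t; rewrite !bracket_model.
  by apply/rowP; elim/forall_ord7;
    rewrite !(coordE, model_mulE) ?(mul0r, mulr0, subr0, addr0).
Qed.

(** The law with [p, [v, p]] = z2, [q, [v, q]] = z1 and [p, [v, q]] = [p, q] = 0. *)
Definition normal_coef : nat -> K := nth 0 [:: 0; 1; 0; 0; 1; 0; 0; 0].

Section Recognition.
Variable mu : law K 7.
Hypothesis mu_nilp : nilp3 mu.
Local Notation "[ x , y ]" := (bracket mu x y).

(** The base change is the frame itself; the brackets of frame vectors not listed here are forced by
    its shape or by nilpotency. *)
Lemma frame_model v p q phi psi c :
    minor phi psi [v, [v, p]] [v, [v, q]] != 0 ->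
    [p, [v, p]] = c 0%N *: [v, [v, p]] + c 1%N *: [v, [v, q]] ->
    [p, [v, q]] = c 2%N *: [v, [v, p]] + c 3%N *: [v, [v, q]] ->
    [q, [v, p]] = c 2%N *: [v, [v, p]] + c 3%N *: [v, [v, q]] ->
    [q, [v, q]] = c 4%N *: [v, [v, p]] + c 5%N *: [v, [v, q]] ->
    [p, q] = c 6%N *: [v, [v, p]] + c 7%N *: [v, [v, q]] ->
  gl_orbit mu (model c).
Proof.
move=> d0 pp pq qp qq e.
have uE := frame_unit mu_nilp d0; exists (frame mu v p q) => //.
apply: law_ext => x y; rewrite bracket_gl_act bracket_model.
apply: (can_inj (mulmxK uE)); rewrite mulmxKV //.
rewrite !mulmx_frame !model_mulE.
have C := bracketC mu_nilp.
have wp u : [[v, p], u] = - [u, [v, p]] by [].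
have wq u : [[v, q], u] = - [u, [v, q]] by [].
have zp u : [[v, [v, p]], u] = 0 by rewrite C (bracket_nilpr mu_nilp) oppr0.
have zq u : [[v, [v, q]], u] = 0 by rewrite C (bracket_nilpr mu_nilp) oppr0.
rewrite !bracketE !zp !zq !(bracket_nilpr mu_nilp) !(bracket_derived mu_nilp).
rewrite !wp !wq !(bracketxx mu_nilp) pp pq qp qq (C q p) (C p v) (C q v) e.
by row_ring.
Qed.

End Recognition.
End Model.

(** * The normal form *)

Section NormalForm.
Variables (K : closedFieldType) (mu : law K 7).
Hypothesis mu_nilp : nilp3 mu.
Local Notation "[ x , y ]" := (bracket mu x y).
Variables (phi psi : 'cV[K]_7).
Local Notation d := (minor phi psi).

(** Factorization of al X^2 + si X Y + ga Y^2 into a1 X + a2 Y and b1 X + b2 Y: Y is a factor if al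
    = 0, otherwise X - r Y is one for a root r of al T^2 + si T + ga. *)
Lemma split_binary_quadratic (al si ga : K) : exists a1 a2 b1 b2,
  [/\ a1 * b1 = al, a1 * b2 + a2 * b1 = si & a2 * b2 = ga].
Proof.
have [->|al0] := eqVneq al 0.
  by exists 0, 1, si, ga; split; ring.
have [r hr] := @solve_monicpoly K 2 (nth 0 [:: - ga / al; - si / al]) isT.
exists 1, (- r), al, (si + r * al); split; try ring.
move: hr; rewrite !big_ord_recl big_ord0 /= => hr.
transitivity (- (si * r + al * r ^+ 2)); first ring.
by rewrite hr; field.
Qed.

Lemma cube_root (a : K) : exists x, x ^+ 3 = a.
Proof.
have [r hr] := @solve_monicpoly K 3 (nth 0 [:: a; 0; 0]) isT.
by exists r; rewrite hr !big_ord_recl big_ord0 /=; ring.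
Qed.

Section Diagonal.
Variables v a b : 'rV[K]_7.
Hypothesis d0 : d [v, [v, a]] [v, [v, b]] != 0.
Hypothesis ab : [a, [v, b]] = 0.
Hypothesis v_ab : [v, [a, b]] = 0.
Hypothesis dQ : d [a, [v, a]] [b, [v, b]] != 0.
Hypothesis da : d [v, [v, a]] [a, [v, a]] != 0.
Hypothesis db : d [v, [v, b]] [b, [v, b]] != 0.

(** The vectors [a, [v, a]] and [b, [v, b]] form a basis of g^3. In it, [v, [v, a]] and [v, [v, b]]
    have a matrix m with nonzero off-diagonal entries; its diagonal is removed by changing v, and
    scaling does the rest. *)
Lemma diagonal_normal_form : gl_orbit mu (model (normal_coef K)).
Proof.
have C := bracketC mu_nilp.
have ba : [b, [v, a]] = 0 by rewrite (bracket_flip mu_nilp v_ab).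
have cramer := minor_cramer mu_nilp d0.
have top x y z : [v, [x, [y, z]]] = 0 /\ [[x, [y, z]], [v, a]] = 0.
  by rewrite (bracket_nilpr mu_nilp) (bracket_derived mu_nilp).
move: dQ da db; set qa := [a, [v, a]]; set qb := [b, [v, b]] => dQ' da' db'.
have sp x : [v, x] = 0 -> [x, [v, a]] = 0 ->
    x = d x qb / d qa qb *: qa + d qa x / d qa qb *: qb.
  move=> vx xw; have := cramer _ _ _ (top a v a) (top b v b) (conj vx xw).
  move/(congr1 ( *:%R (d qa qb)^-1)).
  rewrite scalerA mulVf // scale1r => e; rewrite [LHS]e -/qa -/qb.
  by row_ring.
have zaE := sp _ (top v v a).1 (top v v a).2.
have zbE := sp _ (top v v b).1 (top v v b).2.
have abE : [a, b] = d [a, b] qb / d qa qb *: qa + d qa [a, b] / d qa qb *: qb.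
  exact: sp _ v_ab (bracket_derived mu_nilp a b v a).
move: zaE zbE abE.
set m11 := _ / _; set m12 := _ / _; set m21 := _ / _; set m22 := _ / _.
set e1 := _ / _; set e2 := _ / _ => zaE zbE abE.
have m12_neq0 : m12 != 0.
  rewrite mulf_neq0 ?invr_eq0 // -oppr_eq0 /minor opprB.
  by rewrite mulrC [X in _ - X]mulrC.
have m21_neq0 : m21 != 0 by rewrite mulf_neq0 ?invr_eq0.
clearbody m11 m12 m21 m22 e1 e2.
(* After v is corrected, scaling a by x and v by l gives the normal form when l x m12 = 1 and l m21
   = x^2, hence x^3 = m21 / m12. *)
have [x xE] := cube_root (m21 / m12).
have x_neq0 : x != 0.
  apply: contraTneq isT => x0; move: xE; rewrite x0 expr0n /= => /esym/eqP.
  by rewrite mulf_eq0 invr_eq0 (negPf m12_neq0) (negPf m21_neq0).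
pose l := (x * m12)^-1.
have l_neq0 : l != 0 by rewrite invr_eq0 mulf_neq0.
(* Subtracting m11 a + m22 b cancels the diagonal of m; the terms in [v, b] and [v, a] added to a
   and b cancel [a, b]. *)
pose v' := l *: (v - m11 *: a - m22 *: b).
pose a' := x *: (a + e2 *: [v, b]).
pose b' := b - e1 *: [v, a].
have qa0 u : [u, qa] = 0 by rewrite (bracket_nilpr mu_nilp).
have qb0 u : [u, qb] = 0 by rewrite (bracket_nilpr mu_nilp).
have wb u : [[v, b], u] = - [u, [v, b]] by [].
have w1E : [v', a'] = (l * x) *: ([v, a] + (e2 * m21 + m22 * e1) *: qa
     + (e2 * m22) *: qb).
  rewrite !bracketE (bracketxx mu_nilp) (C b a) ab abE zbE -/qb.
  by row_ring.
have w2E : [v', b'] =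
    l *: ([v, b] - (e1 * m11) *: qa - (e1 * m12 + m11 * e2) *: qb).
  rewrite !bracketE (bracketxx mu_nilp) ba abE zaE -/qa.
  by row_ring.
have uw1 u : [u, [v', a']] = (l * x) *: [u, [v, a]].
  by rewrite w1E !bracketE qa0 qb0 !scaler0 !addr0.
have uw2 u : [u, [v', b']] = l *: [u, [v, b]].
  by rewrite w2E !bracketE qa0 qb0 !scaler0 oppr0 !addr0.
have z1E : [v', [v', a']] = l *: qb.
  rewrite uw1 !bracketE zaE ba -/qa.
  rewrite -{3}[l]mulr1 -(mulVf (mulf_neq0 x_neq0 m12_neq0)) -/l.
  by row_ring.
have z2E : [v', [v', b']] = (l * x ^+ 2) *: qa.
  have -> : x ^+ 2 = l * m21.
    have -> : m21 = x ^+ 3 * m12 by rewrite xE divfK.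
    by rewrite /l; field; rewrite x_neq0 m12_neq0.
  rewrite uw2 !bracketE zbE ab -/qb.
  by row_ring.
apply: (@frame_model _ _ mu_nilp v' a' b' phi psi); rewrite /normal_coef /=.
- rewrite z1E z2E /minor !pairingE.
  rewrite (_ : _ - _ = - (l * (l * x ^+ 2)) * d qa qb);
    last by rewrite /minor; ring.
  by rewrite !(mulf_neq0, oppr_eq0, expf_neq0).
- rewrite uw1 z1E z2E !bracketE !(bracket_derived mu_nilp) -/qa.
  by row_ring.
- rewrite uw2 !scale0r !bracketE !(bracket_derived mu_nilp) ab.
  by rewrite !(scaler0, addr0).
- rewrite uw1 !scale0r !bracketE !(bracket_derived mu_nilp) ba.
  by rewrite !(scaler0, oppr0, addr0).
- rewrite uw2 z1E z2E !bracketE !(bracket_derived mu_nilp) -/qb.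
  by row_ring.
rewrite !scale0r !bracketE (bracket_derived mu_nilp) abE wb -/qa -/qb.
by row_ring.
Qed.
End Diagonal.
End NormalForm.

(* [al, si, ga] are the coefficients of the quadric on P = <p, q> spanning the
   kernel of Sym^2 P -> g^3, x y |-> [x, [v, y]], and [f0 .. f3] those of the
   cubic form x |-> d([v, [v, x]], [x, [v, x]]); the last factor is the
   resultant of the two, and the middle one the discriminant of the quadric. *)
Definition plane_invariant (K : fieldType) (n : nat)
    (phi psi : 'cV[K]_n) (mu : law K n) (v p q : 'rV[K]_n) : K :=
  let d := minor phi psi in
  let b := bracket mu in
  let zp := b v (b v p) in let zq := b v (b v q) in
  let A := b p (b v p) in let B := b p (b v q) in let C := b q (b v q) in
  let al := d B C in let si := d C A in let ga := d A B in
  let f0 := d zp A in let f1 := 2 * d zp B + d zq A in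
  let f2 := d zp C + 2 * d zq B in let f3 := d zq C in
  d zp zq * (si ^+ 2 - 4 * al * ga) *
  (f0 ^+ 2 * al ^+ 3 + f0 * f1 * al ^+ 2 * si
   + f0 * f2 * al * (si ^+ 2 - 2 * al * ga)
   + f0 * f3 * (si ^+ 3 - 3 * al * ga * si)
   + f1 ^+ 2 * al ^+ 2 * ga + f1 * f2 * al * ga * si
   + f1 * f3 * ga * (si ^+ 2 - 2 * al * ga)
   + f2 ^+ 2 * al * ga ^+ 2 + f2 * f3 * ga ^+ 2 * si + f3 ^+ 2 * ga ^+ 3).

(* The multiple of [y + <v>] and the multiple of [t + <v>] used here span a
   plane whose brackets are central. *)
Definition frame_invariant (K : fieldType) (n : nat)
    (phi psi : 'cV[K]_n) (v y t : 'rV[K]_n) (mu : law K n) : K :=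
  let d := minor phi psi in
  let b := bracket mu in
  let zy := b v (b v y) in let zt := b v (b v t) in
  let u := b v (b y t) in
  plane_invariant phi psi mu v
    (d zy zt *: y - d zy u *: v) (d zy zt *: t + d u zt *: v).

(** * Planes with central brackets and recognition of the normal form *)

Section IsotropicPlane.
Variables (K : fieldType) (mu : law K 7).
Hypothesis mu_nilp : nilp3 mu.
Local Notation "[ x , y ]" := (bracket mu x y).
Variables (phi psi : 'cV[K]_7) (v y t : 'rV[K]_7).
Local Notation d := (minor phi psi).
Let zy := [v, [v, y]].
Let zt := [v, [v, t]].
Let u := [v, [y, t]].
Hypothesis zyt : d zy zt != 0.

(** Adding multiples of v to y and t changes [v, [y, t]] by a combination of [zy] and [zt]; Cramer's
    coefficients, cleared of denominators, cancel it. *)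
Lemma isotropic_plane :
  [v, [d zy zt *: y - d zy u *: v, d zy zt *: t + d u zt *: v]] = 0.
Proof.
have top x z : [v, [v, [x, z]]] = 0 /\ [[v, [x, z]], [v, y]] = 0.
  by rewrite (bracket_nilpr mu_nilp) (bracket_derived mu_nilp).
have uE := minor_cramer mu_nilp zyt (top v y) (top v t) (top y t).
rewrite !bracketE (bracketxx mu_nilp) (bracketC mu_nilp y v) !bracketE.
transitivity (d zy zt *: (d zy zt *: u - (d u zt *: zy + d zy u *: zt))).
  by rewrite -/zy -/zt -/u; row_ring.
by rewrite uE subrr scaler0.
Qed.

(** On the plane of [isotropic_plane], [p, q] and the triple brackets lie in the span of the top
    vectors; the parameters are their coordinates. *)
Lemma frame_model_exists : exists c, gl_orbit mu (model c).
Proof.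
set p := d zy zt *: y - d zy u *: v; set q := d zy zt *: t + d u zt *: v.
have zpE : [v, [v, p]] = d zy zt *: zy.
  by rewrite !bracketE (bracketxx mu_nilp) !(bracket0r, scaler0, oppr0, addr0).
have zqE : [v, [v, q]] = d zy zt *: zt.
  by rewrite !bracketE (bracketxx mu_nilp) !(bracket0r, scaler0, addr0).
have d0 : d [v, [v, p]] [v, [v, q]] != 0.
  rewrite zpE zqE (_ : minor _ _ _ _ = d zy zt ^+ 3) ?expf_neq0 //.
  by rewrite /minor !pairingE; ring.
have vpq : [v, [p, q]] = 0 := isotropic_plane.
have qp : [q, [v, p]] = [p, [v, q]] by exact: bracket_flip.
have span := frame_top_span mu_nilp d0.
have sp x w z : exists a b, [x, [w, z]] = a *: [v, [v, p]] + b *: [v, [v, q]].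
  by apply: span; [exact: bracket_nilpr | exact: bracket_derived].
have [a1 [a2 ppE]] := sp p v p.
have [b1 [b2 pqE]] := sp p v q.
have [c1 [c2 qqE]] := sp q v q.
have [e1 [e2 eE]] := span _ vpq (bracket_derived mu_nilp _ _ _ _).
exists (nth 0 [:: a1; a2; b1; b2; c1; c2; e1; e2]).
by apply: (frame_model mu_nilp d0); rewrite ?qp.
Qed.

End IsotropicPlane.

Section Recognition.
Variables (K : closedFieldType) (mu : law K 7).
Hypothesis mu_nilp : nilp3 mu.
Local Notation "[ x , y ]" := (bracket mu x y).
Variables (phi psi : 'cV[K]_7).
Local Notation d := (minor phi psi).

(** Cramer's relation al A + si B + ga C = 0 says that the quadric is in the kernel of Sym^2 P ->
    g^3. Its factors a and b then satisfy [a, [v, b]] = 0 and reduce the claim to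
    [diagonal_normal_form]. *)
Lemma plane_invariant_normal_form v p q :
    [v, [p, q]] = 0 -> plane_invariant phi psi mu v p q != 0 ->
  gl_orbit mu (model (normal_coef K)).
Proof.
move=> v_pq; rewrite /plane_invariant.
have qp : [q, [v, p]] = [p, [v, q]] by exact: bracket_flip.
have [a1 [a2 [b1 [b2]]]] := split_binary_quadratic
  (d [p, [v, q]] [q, [v, q]]) (d [q, [v, q]] [p, [v, p]])
  (d [p, [v, p]] [p, [v, q]]).
move=> [alE siE gaE]; rewrite -alE -siE -gaE.
rewrite !mulf_eq0 !negb_or => /andP[/andP[d0 dis] res].
pose a := a1 *: p + a2 *: q; pose b := b1 *: p + b2 *: q.
have zaE : [v, [v, a]] = a1 *: [v, [v, p]] + a2 *: [v, [v, q]].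
  by rewrite !bracketE.
have zbE : [v, [v, b]] = b1 *: [v, [v, p]] + b2 *: [v, [v, q]].
  by rewrite !bracketE.
have qaE : [a, [v, a]] = a1 ^+ 2 *: [p, [v, p]] + (2 * a1 * a2) *: [p, [v, q]]
  + a2 ^+ 2 *: [q, [v, q]].
  by rewrite !bracketE qp; row_ring.
have qbE : [b, [v, b]] = b1 ^+ 2 *: [p, [v, p]] + (2 * b1 * b2) *: [p, [v, q]]
  + b2 ^+ 2 *: [q, [v, q]].
  by rewrite !bracketE qp; row_ring.
have top x y z : [v, [x, [y, z]]] = 0 /\ [[x, [y, z]], [v, p]] = 0.
  by rewrite (bracket_nilpr mu_nilp) (bracket_derived mu_nilp).
have cr := minor_cramer mu_nilp d0 (top p v p) (top p v q) (top q v q).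
move: alE siE gaE cr qaE qbE d0 zaE zbE res; rewrite -/a -/b.
set A := [p, [v, p]]; set B := [p, [v, q]]; set C := [q, [v, q]].
set zp := [v, [v, p]]; set zq := [v, [v, q]].
move=> alE siE gaE cr qaE qbE d0 zaE zbE res.
have qab : [a, [v, b]] = 0.
  transitivity ((a1 * b1) *: A + (a1 * b2 + a2 * b1) *: B + (a2 * b2) *: C).
    by rewrite !bracketE qp -/A -/B -/C; row_ring.
  by rewrite alE siE gaE cr /minor; row_ring.
(* The discriminant is the squared determinant of (a, b), so a and b are independent. *)
have dE : (a1 * b2 + a2 * b1) ^+ 2 - 4 * (a1 * b1) * (a2 * b2)
    = (a1 * b2 - a2 * b1) ^+ 2 by ring.
move: dis; rewrite dE expf_eq0 /= => dis.
have dQ : d [a, [v, a]] [b, [v, b]] = - (a1 * b2 - a2 * b1) ^+ 3.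
  transitivity ((a1 ^+ 2 * (2 * b1 * b2) - (2 * a1 * a2) * b1 ^+ 2) * d A B
    - (a1 ^+ 2 * b2 ^+ 2 - a2 ^+ 2 * b1 ^+ 2) * d C A
    + ((2 * a1 * a2) * b2 ^+ 2 - a2 ^+ 2 * (2 * b1 * b2)) * d B C).
    by rewrite qaE qbE /minor !pairingE; ring.
  by rewrite -alE -siE -gaE; ring.
have dz : d [v, [v, a]] [v, [v, b]] = (a1 * b2 - a2 * b1) * d zp zq.
  by rewrite zaE zbE /minor !pairingE; ring.
have da : d [v, [v, a]] [a, [v, a]] = d zp A * a1 ^+ 3
    + (2 * d zp B + d zq A) * (a1 ^+ 2 * a2)
    + (d zp C + 2 * d zq B) * (a1 * a2 ^+ 2) + d zq C * a2 ^+ 3.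
  by rewrite zaE qaE /minor !pairingE; ring.
have db : d [v, [v, b]] [b, [v, b]] = d zp A * b1 ^+ 3
    + (2 * d zp B + d zq A) * (b1 ^+ 2 * b2)
    + (d zp C + 2 * d zq B) * (b1 * b2 ^+ 2) + d zq C * b2 ^+ 3.
  by rewrite zbE qbE /minor !pairingE; ring.
(* The resultant is the product of the values of the cubic form at a and b. *)
have : d [v, [v, a]] [a, [v, a]] * d [v, [v, b]] [b, [v, b]] != 0.
  rewrite da db; apply: contraNneq res => res; apply/eqP; rewrite -[RHS]res.
  move: (d zp A) (d zp B) (d zp C) (d zq A) (d zq B) (d zq C) => *; ring.
rewrite mulf_eq0 negb_or => /andP[da0 db0].
apply: (@diagonal_normal_form _ _ mu_nilp phi psi v a b) => //.
- by rewrite dz mulf_neq0.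
- rewrite !bracketE !(bracketxx mu_nilp) (bracketC mu_nilp q p).
  by rewrite !bracketE v_pq !(scaler0, addr0, oppr0).
- by rewrite dQ oppr_eq0 expf_neq0.
Qed.

Lemma frame_invariant_normal_form v y t :
  frame_invariant phi psi v y t mu != 0 -> gl_orbit mu (model (normal_coef K)).
Proof.
rewrite /frame_invariant; set D := d _ _; set m := d _ _; set k := d _ _.
(* If D = 0, both vectors of the plane are multiples of v and the invariant vanishes. *)
have [D0|D0] := eqVneq D 0.
  rewrite D0 !scale0r add0r /plane_invariant !bracketE (bracketxx mu_nilp).
  by rewrite !(bracket0r, scaler0, oppr0) /minor !pairing0 !(mul0r, subr0) eqxx.
by apply: plane_invariant_normal_form; exact: isotropic_plane.
Qed.

End Recognition.

(** * Polynomial dependence on the law *)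

Section PolynomialClass.
Variables (K : fieldType) (T : Type) (P : (T -> K) -> Prop).

(** Closure rules shared by polynomial functions of a law and of a line parameter, so that
    polynomiality is proved once for both. *)
Definition polynomial_class : Prop :=
  [/\ forall f g, f =1 g -> P f -> P g, forall a, P (fun=> a),
      forall f g, P f -> P g -> P (fun t => f t + g t) &
      forall f g, P f -> P g -> P (fun t => f t * g t)].

Hypothesis classP : polynomial_class.

Lemma pclass_ext f g : f =1 g -> P f -> P g.
Proof. by case: classP => h _ _ _; apply: h. Qed.

Lemma pclass_cst a : P (fun=> a).
Proof. by case: classP. Qed.

Lemma pclassD f g : P f -> P g -> P (fun t => f t + g t).
Proof. by case: classP => _ _ h _; apply: h. Qed.

Lemma pclassM f g : P f -> P g -> P (fun t => f t * g t).
Proof. by case: classP => _ _ _; apply. Qed.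

Lemma pclassN f : P f -> P (fun t => - f t).
Proof.
move=> Pf; apply: pclass_ext (pclassM (pclass_cst (-1)) Pf) => t.
exact: mulN1r.
Qed.

Lemma pclassX f n : P f -> P (fun t => f t ^+ n).
Proof.
move=> Pf; elim: n => [|n IHn]; first exact: (pclass_cst 1).
by apply: pclass_ext (pclassM Pf IHn) => t; rewrite exprS.
Qed.

Lemma pclass_sum (I : Type) (r : seq I) (F : I -> T -> K) :
  (forall i, P (F i)) -> P (fun t => \sum_(i <- r) F i t).
Proof.
move=> PF; elim: r => [|i r IHr].
  by apply: pclass_ext (pclass_cst 0) => t; rewrite big_nil.
by apply: pclass_ext (pclassD (PF i) IHr) => t; rewrite big_cons.
Qed.

Lemma pclass_prod (I : Type) (r : seq I) (F : I -> T -> K) :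
  (forall i, P (F i)) -> P (fun t => \prod_(i <- r) F i t).
Proof.
move=> PF; elim: r => [|i r IHr].
  by apply: pclass_ext (pclass_cst 1) => t; rewrite big_nil.
by apply: pclass_ext (pclassM (PF i) IHr) => t; rewrite big_cons.
Qed.

Lemma pclass_meval n (p : {mpoly K[n]}) (c : T -> 'I_n -> K) :
  (forall i, P (fun t => c t i)) -> P (fun t => p.@[c t]).
Proof.
move=> Pc.
apply: (@pclass_ext (fun t => \sum_(m <- msupp p) p@_m * \prod_i c t i ^+ m i)).
  by move=> t; rewrite mevalE.
apply: pclass_sum => m; apply: pclassM; first exact: pclass_cst.
by apply: pclass_prod => i; apply: pclassX.
Qed.

Section Laws.
Variable n : nat.
Implicit Types (x y : T -> 'rV[K]_n) (M : T -> law K n).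

Definition vec_class x := forall k, P (fun t => x t 0 k).
Definition law_class M := forall t, P (fun s => M s t).

Lemma vec_class_cst (x : 'rV[K]_n) : vec_class (fun=> x).
Proof. by move=> k; exact: pclass_cst. Qed.

Lemma vec_classD x y :
  vec_class x -> vec_class y -> vec_class (fun t => x t + y t).
Proof.
move=> Px Py k; apply: pclass_ext (pclassD (Px k) (Py k)) => t.
by rewrite mxE.
Qed.

Lemma vec_classN x : vec_class x -> vec_class (fun t => - x t).
Proof.
by move=> Px k; apply: pclass_ext (pclassN (Px k)) => t; rewrite mxE.
Qed.

Lemma vec_classZ f x : P f -> vec_class x -> vec_class (fun t => f t *: x t).
Proof.
by move=> Pf Px k; apply: pclass_ext (pclassM Pf (Px k)) => t; rewrite mxE.
Qed.

Lemma vec_class_bracket M x y : law_class M -> vec_class x -> vec_class y ->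
  vec_class (fun t => bracket (M t) (x t) (y t)).
Proof.
move=> PM Px Py k.
apply: (@pclass_ext (fun t => \sum_i \sum_j x t 0 i * y t 0 j * M t (i, j, k))).
  by move=> t; rewrite mxE.
apply: pclass_sum => i; apply: pclass_sum => j.
by apply: pclassM; first exact: pclassM.
Qed.

Lemma pclass_mulmx m (x : T -> 'rV[K]_n) (f : 'M[K]_(n, m)) k :
  vec_class x -> P (fun t => (x t *m f) 0 k).
Proof.
move=> Px; apply: (@pclass_ext (fun t => \sum_j x t 0 j * f j k)).
  by move=> t; rewrite mxE.
by apply: pclass_sum => j; apply: pclassM => //; exact: pclass_cst.
Qed.

Lemma law_class_gl_act f M : law_class M -> law_class (fun t => gl_act f (M t)).
Proof.
move=> PM t.
apply: (@pclass_ext (fun s => (bracket (M s) (delta_mx 0 t.1.1 *m f)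
  (delta_mx 0 t.1.2 *m f) *m invmx f) 0 t.2)).
  by move=> s; rewrite ffunE.
by apply: pclass_mulmx; apply: vec_class_bracket => //; exact: vec_class_cst.
Qed.

Lemma pclass_minor phi psi x y :
  vec_class x -> vec_class y -> P (fun t => minor phi psi (x t) (y t)).
Proof.
move=> Px Py; rewrite /minor; apply: pclassD; last apply: pclassN.
  by apply: pclassM; exact: pclass_mulmx.
by apply: pclassM; exact: pclass_mulmx.
Qed.

(** The invariant uses brackets, minors, sums and products but no division, so the closure rules
    apply term by term. *)
Lemma pclass_frame_invariant phi psi (v y t : 'rV[K]_n) M :
  law_class M -> P (fun s => frame_invariant phi psi v y t (M s)).
Proof.
move=> PM.
have Pv : vec_class (fun=> v) by exact: vec_class_cst.
have Py : vec_class (fun=> y) by exact: vec_class_cst.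
have Pt : vec_class (fun=> t) by exact: vec_class_cst.
have Pplane p q : vec_class p -> vec_class q ->
    P (fun s => plane_invariant phi psi (M s) v (p s) (q s)).
  move=> Pp Pq; rewrite /plane_invariant /=.
  by repeat first [assumption | exact: pclass_cst | apply: pclass_minor
    | apply: pclassX | apply: pclassM | apply: pclassD | apply: pclassN
    | apply: vec_class_bracket].
rewrite /frame_invariant /=; apply: Pplane.
all: by repeat first [assumption | apply: vec_classD | apply: vec_classN
  | apply: vec_classZ | apply: pclass_minor | apply: vec_class_bracket].
Qed.

End Laws.

Lemma law_class_model (c : T -> nat -> K) :
  (forall i, P (fun t => c t i)) -> law_class (fun t => model (c t)).
Proof.
move=> Pc [[i j] k].
apply: (@pclass_ext
          (fun t => model_mul (c t) (delta_mx 0 i) (delta_mx 0 j) 0 k)).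
  by move=> t; rewrite ffunE.
elim/forall_ord7: k; (eapply pclass_ext;
  [by move=> t; symmetry; rewrite model_mulE; reflexivity
  |by repeat first [exact: pclass_cst | apply: Pc | apply: pclassD
     | apply: pclassM]]).
Qed.

End PolynomialClass.

Section Instances.
Variable K : fieldType.

Lemma polynomial_class_mpoly n : polynomial_class (fun f : law K n -> K =>
  exists p : {mpoly K[_]}, forall mu, p.@[coords mu] = f mu).
Proof.
split=> [f g fg [p pf]|a|f g [p pf] [q qg]|f g [p pf] [q qg]].
- by exists p => mu; rewrite pf.
- by exists a%:MP => mu; rewrite mevalC.
- by exists (p + q) => mu; rewrite mevalD pf qg.
- by exists (p * q) => mu; rewrite mevalM pf qg.
Qed.

Lemma law_class_id n : law_class (fun f : law K n -> K =>
  exists p : {mpoly K[_]}, forall mu, p.@[coords mu] = f mu) id.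
Proof.
move=> t; exists 'X_(enum_rank t) => mu.
by rewrite mevalXU /coords enum_rankK.
Qed.

Lemma polynomial_class_poly : polynomial_class (fun f : K -> K =>
  exists p : {poly K}, forall t, p.[t] = f t).
Proof.
split=> [f g fg [p pf]|a|f g [p pf] [q qg]|f g [p pf] [q qg]].
- by exists p => t; rewrite pf.
- by exists a%:P => t; rewrite hornerC.
- by exists (p + q) => t; rewrite hornerD pf qg.
- by exists (p * q) => t; rewrite hornerM pf qg.
Qed.

End Instances.

(** * The law of g *)

Section GLaw.
Variable K : fieldType.
Implicit Types x y : 'rV[K]_7.

Lemma g_lawE (i j k : 'I_7) (b b' : bool) :
    ((i.+1, j.+1, k.+1) \in g_terms) = b ->
    ((j.+1, i.+1, k.+1) \in g_terms) = b' ->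
  g_law K (i, j, k) = b%:R - b'%:R.
Proof. by move=> <- <-; rewrite ffunE. Qed.

Definition g_mul x y : 'rV[K]_7 :=
  let s i j := x 0 i * y 0 j - x 0 j * y 0 i in
  \row_k [:: 0; 0; s i0 i1; s i0 i2 + s i1 i2 + s i4 i5; 0;
             s i0 i4 + s i1 i4; s i0 i5 + s i1 i2 + s i2 i4]`_k.

Lemma bracket_g_law x y : bracket (g_law K) x y = g_mul x y.
Proof.
have g0 (i j k : 'I_7) : ((i.+1, j.+1, k.+1) \in g_terms) = false ->
    ((j.+1, i.+1, k.+1) \in g_terms) = false -> g_law K (i, j, k) = 0.
  by move=> h h'; rewrite (g_lawE h h') subrr.
have g1 (i j k : 'I_7) : ((i.+1, j.+1, k.+1) \in g_terms) = true ->
    ((j.+1, i.+1, k.+1) \in g_terms) = false -> g_law K (i, j, k) = 1.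
  by move=> h h'; rewrite (g_lawE h h') subr0.
have gN (i j k : 'I_7) : ((i.+1, j.+1, k.+1) \in g_terms) = false ->
    ((j.+1, i.+1, k.+1) \in g_terms) = true -> g_law K (i, j, k) = - 1.
  by move=> h h'; rewrite (g_lawE h h') sub0r.
apply/rowP; elim/forall_ord7; rewrite !mxE !sum_ord7 /=.
(* Each structure constant is 0, 1 or -1; computation decides the membership tests. *)
all: repeat match goal with |- context [fun_of_fin (g_law K) (?i, ?j, ?k)] =>
  first [ rewrite (@g0 i j k erefl erefl) | rewrite (@g1 i j k erefl erefl)
        | rewrite (@gN i j k erefl erefl) ] end.
all: by coord_ring.
Qed.

Lemma g_mulE x y : let s i j := x 0 i * y 0 j - x 0 j * y 0 i in
  ((g_mul x y 0 i0 = 0) * (g_mul x y 0 i1 = 0) *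
   (g_mul x y 0 i2 = s i0 i1) *
   (g_mul x y 0 i3 = (s i0 i2 + s i1 i2 + s i4 i5)%R) *
   (g_mul x y 0 i4 = 0) * (g_mul x y 0 i5 = (s i0 i4 + s i1 i4)%R) *
   (g_mul x y 0 i6 = (s i0 i5 + s i1 i2 + s i2 i4)%R))%type.
Proof. by rewrite /= !mxE. Qed.

Lemma g_law_nilp3 : nilp3 (g_law K).
Proof.
split; first split.
- move=> x; rewrite bracket_g_law.
  by apply/rowP; elim/forall_ord7; rewrite !(coordE, g_mulE); coord_ring.
- move=> x y z; rewrite !bracket_g_law.
  by apply/rowP; elim/forall_ord7; rewrite !(coordE, g_mulE); coord_ring.
- move=> x y z t; rewrite !bracket_g_law.
  by apply/rowP; elim/forall_ord7; rewrite !(coordE, g_mulE); coord_ring.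
Qed.

Local Notation e i := (delta_mx 0 i : 'rV[K]_7).
Local Notation f i := (delta_mx i 0 : 'cV[K]_7).

Ltac basis_bracket E :=
  apply/rowP; elim/forall_ord7; rewrite E !mxE /normal_coef /=; ring.

Lemma pairing_delta (i j : 'I_7) : pairing (f i) (e j) = (i == j)%:R.
Proof. by rewrite /pairing mul_delta_mx_cond mulmxnE mxE eqxx eq_sym. Qed.

(** Here v, y, t are X_1, X_2, X_5, and the forms read off X_4 and X_7. The plane is spanned by p =
    X_2 - X_1 and q = X_5, the quadric is p (p + q), and the cubic takes the values 1 and -2 at its
    factors. *)
Lemma g_law_frame_invariant :
  frame_invariant (f i3) (f i6) (e i0) (e i1) (e i4) (g_law K) = - 2.
Proof.
have ev x y z : g_mul x y = z -> bracket (g_law K) x y = z.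
  by rewrite bracket_g_law.
have e01 : bracket (g_law K) (e i0) (e i1) = e i2.
  by apply: ev; basis_bracket g_mulE.
have e04 : bracket (g_law K) (e i0) (e i4) = e i5.
  by apply: ev; basis_bracket g_mulE.
have e02 : bracket (g_law K) (e i0) (e i2) = e i3.
  by apply: ev; basis_bracket g_mulE.
have e05 : bracket (g_law K) (e i0) (e i5) = e i6.
  by apply: ev; basis_bracket g_mulE.
have e14 : bracket (g_law K) (e i1) (e i4) = e i5.
  by apply: ev; basis_bracket g_mulE.
have e12 : bracket (g_law K) (e i1) (e i2) = e i3 + e i6.
  by apply: ev; basis_bracket g_mulE.
have e15 : bracket (g_law K) (e i1) (e i5) = 0.
  by apply: ev; basis_bracket g_mulE.
have e45 : bracket (g_law K) (e i4) (e i5) = e i3.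
  by apply: ev; basis_bracket g_mulE.
have e00 := bracketxx g_law_nilp3 (e i0).
rewrite /frame_invariant e01 e04 e14 e02 e05.
have -> : minor (f i3) (f i6) (e i3) (e i6) = 1.
  by rewrite /minor !pairing_delta /= mulr1 mulr0 subr0.
have -> : minor (f i3) (f i6) (e i6) (e i6) = 0.
  by rewrite /minor mulrC subrr.
rewrite scale0r addr0 !scale1r /plane_invariant /= !bracketE.
rewrite e00 !(subr0, bracket0r) e01 e04 e02 e05 e12 e15 e45.
by rewrite /minor !pairingE !pairing_delta /=; ring.
Qed.

(** The quadric is p q and the cubic takes the values 1 at p and -1 at q. Hence the invariant is not
    identically zero on the family. *)
Lemma normal_frame_invariant :
  frame_invariant (f i5) (f i6) (e i0) (e i1) (e i2) (model (normal_coef K))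
    = - 1.
Proof.
set mu := model _.
have ev x y z : model_mul (normal_coef K) x y = z -> bracket mu x y = z.
  by rewrite bracket_model.
have e01 : bracket mu (e i0) (e i1) = e i3.
  by apply: ev; basis_bracket model_mulE.
have e02 : bracket mu (e i0) (e i2) = e i4.
  by apply: ev; basis_bracket model_mulE.
have e03 : bracket mu (e i0) (e i3) = e i5.
  by apply: ev; basis_bracket model_mulE.
have e04 : bracket mu (e i0) (e i4) = e i6.
  by apply: ev; basis_bracket model_mulE.
have e12 : bracket mu (e i1) (e i2) = 0.
  by apply: ev; basis_bracket model_mulE.
have e13 : bracket mu (e i1) (e i3) = e i6.
  by apply: ev; basis_bracket model_mulE.
have e14 : bracket mu (e i1) (e i4) = 0.
  by apply: ev; basis_bracket model_mulE.
have e24 : bracket mu (e i2) (e i4) = e i5.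
  by apply: ev; basis_bracket model_mulE.
rewrite /frame_invariant e01 e02 e12 e03 e04 bracket0r.
have -> : minor (f i5) (f i6) (e i5) (e i6) = 1.
  by rewrite /minor !pairing_delta /= mulr1 mulr0 subr0.
have -> : minor (f i5) (f i6) (e i5) 0 = 0.
  by rewrite /minor !pairing0 !mulr0 subr0.
have -> : minor (f i5) (f i6) 0 (e i6) = 0.
  by rewrite /minor !pairing0 !mul0r subr0.
rewrite !scale0r subr0 addr0 !scale1r /plane_invariant /=.
rewrite e01 e02 e03 e04 e13 e14 e24.
by rewrite /minor !pairingE !pairing_delta /=; ring.
Qed.

End GLaw.

(** * Jordan blocks *)

Section Jordan.
Variable K : fieldType.

Lemma mulmx_ad n (mu : law K n) (x y : 'rV[K]_n) :
  y *m ad mu x = bracket mu x y.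
Proof.
rewrite mulmx_sum_row (linear_sum_delta y); last first.
  by move=> a u w; rewrite bracketDr bracketZr.
apply: eq_bigr => i _; congr (_ *: _).
by apply/rowP=> j; rewrite /ad mxE [LHS]mxE.
Qed.

(* The top right entry of the square of a 3 x 3 Jordan block is 1 whatever the
   eigenvalue. *)
Lemma jordan_block3_sqr (a : K) :
  (jordan_block 3 a *m jordan_block 3 a) 0 (inord 2) = 1.
Proof.
rewrite mxE !big_ord_recl big_ord0 !mxE -!val_eqE /= inordK //=.
by ring.
Qed.

(** The booleans select a block: one formula serves for the chosen block and for the others, where
    it gives 0. *)
Lemma corner_entry (M : 'M[K]_3) (b b' : bool) :
  (\row_k (b && (k == 0 :> nat))%:R *m M *m
   \col_k (b' && (k == 2 :> nat))%:R) 0 0 = (b && b')%:R * M 0 (inord 2).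
Proof.
have -> : \row_k (b && (k == 0 :> nat))%:R = b%:R *: delta_mx 0 0 :> 'rV[K]_3.
  by apply/rowP=> k; rewrite !mxE /= -natrM mulnb.
have -> : \col_k (b' && (k == 2 :> nat))%:R
    = b'%:R *: delta_mx (inord 2) 0 :> 'cV[K]_3.
  by apply/colP=> k; rewrite !mxE -val_eqE /= inordK // andbT -natrM mulnb.
rewrite -scalemxAr -!scalemxAl -matrix.rowE -colE !mxE mulrA -natrM mulnb.
by rewrite andbC.
Qed.

(** Take for y and t the first basis vectors of the two blocks of size 3, and for [phi] and [psi]
    the last coordinates on these blocks; the minor is then that of the identity matrix. *)
Lemma jordan_sizes_minor n (mu : law K n) (x : 'rV[K]_n) :
    jordan_sizes (ad mu x) [:: 3; 3; 1]%N ->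
  exists y t phi psi,
    minor phi psi (bracket mu x (bracket mu x y))
      (bracket mu x (bracket mu x t)) != 0.
Proof.
set s := [:: 3; 3; 1]%N => -[_ _ [a [P [/row_freeP[P' PP'] _ PA]]]].
pose J (j : 'I_3) := jordan_block (nth 0%N s j) (a j).
pose row0 (i : 'I_3) : 'rV[K]_(\sum_(j < 3) nth 0%N s j) :=
  \mxrow_j \row_(k < nth 0%N s j) ((j == i) && (k == 0 :> nat))%:R.
pose col2 (i : 'I_3) : 'cV[K]_(\sum_(j < 3) nth 0%N s j) :=
  \mxcol_j \col_(k < nth 0%N s j) ((j == i) && (k == 2 :> nat))%:R.
have J2 (i l : 'I_3) : (i < 2)%N ->
    (row0 i *m (\mxdiag_j J j) *m (\mxdiag_j J j) *m col2 l) 0 0 = (i == l)%:R.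
  move=> lti; rewrite !mul_mxrow_mxdiag mul_mxrow_mxcol summxE.
  rewrite (bigD1 i) //= [X in _ + X]big1 ?addr0 => [|k /negPf->]; last first.
    rewrite (_ : \row__ _ = 0) ?mul0mx ?mxE //.
    by apply/rowP=> j; rewrite !mxE.
  rewrite -[X in (X *m _) 0 0]mulmxA eqxx.
  case: i lti => -[|[|//]] lti _ /=; rewrite (corner_entry _ true) andTb;
    by rewrite jordan_block3_sqr mulr1.
(* P intertwines ad(x) with the Jordan matrix, and its right inverse P' turns Jordan coordinates
   into linear forms. *)
have zE i l : pairing (P' *m col2 l) (bracket mu x (bracket mu x (row0 i *m P)))
    = (row0 i *m (\mxdiag_j J j) *m (\mxdiag_j J j) *m col2 l) 0 0.
  rewrite -!mulmx_ad -(mulmxA _ P) PA !mulmxA -(mulmxA _ P) PA !mulmxA.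
  by rewrite /pairing !mulmxA -(mulmxA _ P) PP' mulmx1.
pose o0 := @Ordinal 3 0 isT; pose o1 := @Ordinal 3 1 isT.
exists (row0 o0 *m P), (row0 o1 *m P), (P' *m col2 o0), (P' *m col2 o1).
by rewrite /minor !zE !J2 //= mulr1 mulr0 subr0 oner_eq0.
Qed.

End Jordan.

(** * Orbit and closure *)

Section Orbit.
Variables (K : closedFieldType) (charK0 : [pchar K] =i pred0).
Local Notation e i := (delta_mx 0 i : 'rV[K]_7).
Local Notation f i := (delta_mx i 0 : 'cV[K]_7).

Lemma g_law_frame_invariant_neq0 :
  frame_invariant (f i3) (f i6) (e i0) (e i1) (e i4) (g_law K) != 0.
Proof.
rewrite g_law_frame_invariant oppr_eq0.
(* The value -2 is nonzero in characteristic 0. *)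
by have := charK0 2; rewrite !inE /= => ->.
Qed.

(** Both laws are isomorphic to the same normal form. *)
Lemma gl_orbit_g_law (mu : law K 7) phi psi v y t :
  nilp3 mu -> frame_invariant phi psi v y t mu != 0 -> gl_orbit (g_law K) mu.
Proof.
move=> mu_nilp mu_inv.
have mu_N := frame_invariant_normal_form mu_nilp mu_inv.
apply: gl_orbit_trans (gl_orbit_sym mu_N).
exact: (frame_invariant_normal_form (g_law_nilp3 K)
          g_law_frame_invariant_neq0).
Qed.

Lemma g_law_rigid : rigid_in_nilp3 (g_law K).
Proof.
pose inv := frame_invariant (f i3) (f i6) (e i0) (e i1) (e i4).
(* The invariant refers to fixed basis vectors; allowing every translate by h makes its nonvanishing
   locus stable under GL. *)
exists (fun mu => exists2 h, h \in unitmx & inv (gl_act h mu) != 0).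
  (* The complement is defined by the polynomials that represent the translated invariants. *)
  exists (fun p => exists2 h, h \in unitmx &
    forall mu, p.@[coords mu] = inv (gl_act h mu)) => mu; split=> [noU p|van].
    case=> h uh pE; rewrite pE; apply/eqP; apply: contraPT noU => nz.
    by apply; exists h.
  case=> h uh /eqP; apply.
  have [p pE] := pclass_frame_invariant (polynomial_class_mpoly K 7) (f i3)
    (f i6) (e i0) (e i1) (e i4)
    (law_class_gl_act (polynomial_class_mpoly K 7) h (@law_class_id K 7)).
  by rewrite -[LHS](pE mu) van //; exists h.
move=> mu; split=> [g_mu|[mu_nilp [h uh inv_neq0]]].
  split; first exact: nilp3_gl_orbit g_mu (g_law_nilp3 K).
  have [h uh gE] := gl_orbit_sym g_mu; exists h => //.
  by rewrite -gE; exact: g_law_frame_invariant_neq0.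
apply: gl_orbit_trans (gl_orbit_sym (ex_intro2 _ _ h uh erefl)).
apply: gl_orbit_g_law inv_neq0.
by apply: nilp3_gl_orbit mu_nilp; exists h.
Qed.

(* Along the line from [c] to the normal form, all but finitely many laws have
   a nonzero invariant, hence lie in the orbit of [g_law K]. *)
Lemma gl_act_model_closure h c : h \in unitmx ->
  zariski_closure (gl_orbit (g_law K)) (gl_act h (model c)).
Proof.
move=> uh Z [I ZI] orbZ; apply/ZI => p Ip.
pose c' (t : K) i := c i + t * (normal_coef K i - c i).
have polyP := polynomial_class_poly K.
have c'P i : exists p : {poly K}, forall t, p.[t] = c' t i.
  exists ((c i)%:P + 'X * (normal_coef K i - c i)%:P) => t.
  by rewrite !hornerE.
have modelP := law_class_model polyP c'P.
(* q and r are the restrictions to the line of the equation p and of the invariant. *)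
have [q qE] := pclass_meval polyP p
  (c := fun t => coords (gl_act h (model (c' t))))
  (fun i => law_class_gl_act polyP h modelP (enum_val i)).
have [r rE] := pclass_frame_invariant polyP (f i5) (f i6) (e i0) (e i1) (e i2)
  modelP.
have r_neq0 : r != 0.
  apply/eqP=> r0; have := rE 1; rewrite r0 horner0.
  have -> : model (c' 1) = model (normal_coef K).
    by apply: eq_model => i; rewrite /c' mul1r addrC subrK.
  by rewrite normal_frame_invariant => /esym/eqP; rewrite oppr_eq0 oner_eq0.
(* Where r(t) is nonzero the law is in the orbit, so q(t) = 0. Thus q r vanishes at every t, hence
   is zero over a closed field. *)
have : q * r = 0.
  apply/eqP; apply: contraT => /closed_nonrootP[t].
  rewrite rootE hornerM qE rE mulf_eq0 negb_or => /andP[/negP pt_neq0 inv_neq0].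
  case: pt_neq0; apply/eqP; apply: ((ZI _).1 _ p Ip); apply: orbZ.
  apply: gl_orbit_trans (gl_orbit_g_law (model_nilp3 _) inv_neq0) _.
  by exists h.
move/eqP; rewrite mulf_eq0 (negPf r_neq0) orbF => /eqP q0.
have c'0 : model (c' 0) = model c.
  by apply: eq_model => i; rewrite /c' mul0r addr0.
by have := qE 0; rewrite q0 horner0 c'0.
Qed.

(** The Jordan basis provides a nonzero minor, which makes the law a translate of a member of the
    family. *)
Lemma char_seq331_contraction (mu : law K 7) :
  nilp3 mu -> char_seq mu [:: 3; 3; 1]%N -> contraction (g_law K) mu.
Proof.
move=> mu_nilp [[x _ /jordan_sizes_minor[y [t [phi [psi d0]]]]] _].
split; first by case: mu_nilp.
have [c /gl_orbit_sym[h uh ->]] := frame_model_exists mu_nilp d0.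
exact: gl_act_model_closure.
Qed.

End Orbit.

Theorem proposition21 (K : closedFieldType) (charK0 : [pchar K] =i pred0) :
  rigid_in_nilp3 (g_law K) /\
  (forall mu : law K 7, nilp3 mu -> char_seq mu [:: 3; 3; 1]%N ->
     contraction (g_law K) mu).
Proof.
by split; [exact: g_law_rigid | exact: char_seq331_contraction].
Qed.
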